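(* Let $f:\mathbb{R}^d\to\mathbb{R}$ and $P:\mathbb{R}^d\to\mathbb{R}^s$ be continuously differentiable, $D\subseteq\mathbb{R}^s$ closed, $\Omega=\{z\mid P(z)\in D\}$, and let $\bar z\in\Omega$ be B-stationary for the problem $\min f(z)$ s.t. $P(z)\in D$. Assume that GGCQ holds at $\bar z$ and that the mapping $u\rightrightarrows\nabla P(\bar z)u-T_D(P(\bar z))$ is metrically subregular at $(0,0)$. Then there exist a natural number $k\ge0$, directions $u_1,\dots,u_k\in\mathbb{R}^d$, a direction $w\in T^k_D(P(\bar z);\nabla P(\bar z)u_1,\dots,\nabla P(\bar z)u_k)$ and a multiplier $w^\ast\in\widehat N_{T^k_D(P(\bar z);\nabla P(\bar z)u_1,\dots,\nabla P(\bar z)u_k)}(w)$ such that \[\nabla f(\bar z)+\nabla P(\bar z)^\ast w^\ast=0.\] Moreover, for every $l=1,\dots,k$ we have $u_l\in T^{{\rm lin},l-1}_{P,D}(\bar z;u_1,\dots,u_{l-1})$, $\nabla P(\bar z)u_l\notin\operatorname{Lsp}(T^{l-1}_D(P(\bar z);\nabla P(\bar z)u_1,\dots,\nabla P(\bar z)u_{l-1}))$, $\langle\nabla f(\bar z),u_l\rangle=0$, and $T^{l-1}_D(P(\bar z);\nabla P(\bar z)u_1,\dots,\nabla P(\bar z)u_{l-1})$ is not locally polyhedral near $\nabla P(\bar z)u_l$.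
   Context: Tangent cone: $T_\Omega(\bar z)=\{w\mid \exists t_k\downarrow0,\ w_k\to w,\ \bar z+t_kw_k\in\Omega\}$, with $T_\Omega(\bar z)=\emptyset$ if $\bar z\notin\Omega$. Polar cone $K^\ast=\{z^\ast\mid\langle z^\ast,w\rangle\le0\ \forall w\in K\}$; regular normal cone $\widehat N_\Omega(\bar z)=(T_\Omega(\bar z))^\ast$ (empty if $\bar z\notin\Omega$). Higher-order tangent cones: for $\bar y\in D$ and directions $v_1,v_2,\dots$, $T^0_D(\bar y)=T_D(\bar y)$ and $T^k_D(\bar y;v_1,\dots,v_k)=T_{T^{k-1}_D(\bar y;v_1,\dots,v_{k-1})}(v_k)$ for $k\ge1$. Higher-order linearized tangent cones: $T^{{\rm lin},0}_{P,D}(\bar z)=\{u\mid\nabla P(\bar z)u\in T_D(P(\bar z))\}=:T^{\rm lin}_{P,D}(\bar z)$ and $T^{{\rm lin},k}_{P,D}(\bar z;u_1,\dots,u_k)=\{u\mid\nabla P(\bar z)u\in T^k_D(P(\bar z);\nabla P(\bar z)u_1,\dots,\nabla P(\bar z)u_k)\}$. $\bar z$ is B-stationary if $0\in\nabla f(\bar z)+\widehat N_\Omega(\bar z)$. GGCQ holds at $\bar z$ if $\widehat N_\Omega(\bar z)=(T^{\rm lin}_{P,D}(\bar z))^\ast$. A mapping $M$ is metrically subregular at $(\bar z,\bar w)\in\operatorname{gph}M$ if there are a neighborhood $W$ of $\bar z$ and $\kappa>0$ with $\operatorname{dist}(z,M^{-1}(\bar w))\le\kappa\operatorname{dist}(\bar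 w,M(z))$ for $z\in W$. For a cone $C$, $\operatorname{Lsp}(C)$ is the largest linear subspace $L$ with $C+L\subseteq C$. A set is polyhedral if it is a finite union of finite intersections of closed halfspaces; $\Omega$ is locally polyhedral near $\bar z\in\Omega$ if $\Omega\cap W=C\cap W$ for some neighborhood $W$ of $\bar z$ and polyhedral $C$. *)

(* Defs.v *)
From HB Require Import structures.
From mathcomp Require Import all_boot all_order all_algebra.
From mathcomp Require Import all_classical all_reals all_analysis.
Set Implicit Arguments. Unset Strict Implicit. Unset Printing Implicit Defensive.
Import Order.TTheory GRing.Theory Num.Theory.
Import numFieldNormedType.Exports.
Local Open Scope classical_set_scope.
Local Open Scope ring_scope.

(* R^n is 'rV[R]_n (with its canonical (max-)norm). *)

Section Defs.
Variable R : realType.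

Definition dot (n : nat) (x y : 'rV[R]_n) : R := \sum_(i < n) x 0 i * y 0 i.

Definition ebas (n : nat) (i : 'I_n) : 'rV[R]_n := delta_mx 0 i.

Definition C1 (n : nat) (W : normedModType R) (F : 'rV[R]_n -> W) : Prop :=
  (forall x, differentiable F x) /\
  (forall i : 'I_n, continuous (fun x => 'd F x (ebas i))).

Definition grad (n : nat) (F : 'rV[R]_n -> R^o) (x : 'rV[R]_n) : 'rV[R]_n :=
  \row_(i < n) ('d F x (ebas i)).

Definition adjD (n m : nat) (F : 'rV[R]_n -> 'rV[R]_m) (x : 'rV[R]_n)
  (y : 'rV[R]_m) : 'rV[R]_n := \row_(i < n) dot y ('d F x (ebas i)).

Definition tangent_cone (n : nat) (A : set 'rV[R]_n) (z : 'rV[R]_n) : set 'rV[R]_n :=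
  [set w | A z /\ exists (t : nat -> R) (wk : nat -> 'rV[R]_n),
      (forall k, 0 < t k) /\ t @ \oo --> (0 : R) /\ wk @ \oo --> w /\
      (forall k, A (z + t k *: wk k))].

Definition polar (n : nat) (K : set 'rV[R]_n) : set 'rV[R]_n :=
  [set zs | forall w, K w -> dot zs w <= 0].

Definition normal_cone (n : nat) (A : set 'rV[R]_n) (z : 'rV[R]_n) : set 'rV[R]_n :=
  [set zs | A z /\ polar (tangent_cone A z) zs].

Definition htan (n : nat) (D : set 'rV[R]_n) (y : 'rV[R]_n) (vs : seq 'rV[R]_n)
  : set 'rV[R]_n :=
  foldl (fun C v => tangent_cone C v) (tangent_cone D y) vs.

Definition lin_tan (n m : nat) (F : 'rV[R]_n -> 'rV[R]_m) (D : set 'rV[R]_m)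
  (z : 'rV[R]_n) (us : seq 'rV[R]_n) : set 'rV[R]_n :=
  [set u | htan D (F z) (map ('d F z) us) ('d F z u)].

Definition B_stationary (n : nat) (F : 'rV[R]_n -> R^o) (Om : set 'rV[R]_n)
  (z : 'rV[R]_n) : Prop := normal_cone Om z (- grad F z).

Definition GGCQ (n m : nat) (F : 'rV[R]_n -> 'rV[R]_m) (D : set 'rV[R]_m)
  (z : 'rV[R]_n) : Prop :=
  normal_cone (F @^-1` D) z = polar (lin_tan F D z [::]).

(* distance to a set, +oo for the empty set *)
Definition edist (n : nat) (x : 'rV[R]_n) (S : set 'rV[R]_n) : \bar R :=
  ereal_inf [set (`|x - y|)%:E | y in S].

Definition metric_subregular (n m : nat) (M : 'rV[R]_n -> set 'rV[R]_m)
  (zb : 'rV[R]_n) (wb : 'rV[R]_m) : Prop :=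
  M zb wb /\
  exists W, nbhs zb W /\ exists kappa : R, 0 < kappa /\
    forall z, W z ->
      (edist z [set u | M u wb] <= kappa%:E * edist wb (M z))%E.

Definition subspace (n : nat) (L : set 'rV[R]_n) : Prop :=
  L 0 /\ (forall x y, L x -> L y -> L (x + y)) /\ (forall (a : R) x, L x -> L (a *: x)).

(* membership in Lsp(C), the largest linear subspace L with C + L included in C:
   v lies in Lsp(C) iff it lies in some such subspace *)
Definition Lsp (n : nat) (C : set 'rV[R]_n) : set 'rV[R]_n :=
  [set v | exists L, subspace L /\ (forall c l, C c -> L l -> C (c + l)) /\ L v].

Definition polyhedral (n : nat) (C : set 'rV[R]_n) : Prop :=
  exists (N : nat) (M : nat -> nat) (a : nat -> nat -> 'rV[R]_n) (b : nat -> nat -> R),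
    C = [set x | exists i, (i < N)%N /\ forall j, (j < M i)%N -> dot (a i j) x <= b i j].

Definition locally_polyhedral (n : nat) (A : set 'rV[R]_n) (z : 'rV[R]_n) : Prop :=
  A z /\ exists W, nbhs z W /\ exists C, polyhedral C /\ A `&` W = C `&` W.

End Defs.

(* Main.v *)
Require Import Defs.
From HB Require Import structures.
From mathcomp Require Import all_boot all_order all_algebra.
From mathcomp Require Import all_classical all_reals all_analysis.
From mathcomp Require Import ring lra.
Set Implicit Arguments. Unset Strict Implicit. Unset Printing Implicit Defensive.
Import Order.TTheory GRing.Theory Num.Theory.
Import numFieldNormedType.Exports.
Local Open Scope classical_set_scope.
Local Open Scope ring_scope.

(* Write A = dP(zbar), g = grad f(zbar), C = T_D(P zbar). B-stationarity and GGCQ say that u = 0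
   minimizes <g, u> subject to A u in C, and subregularity turns this into the exact penalty
   inequality <g, u> + L |A u - v| >= 0 for all u and all v in C. Consider the objective
   2 <g, u> + |A u - v|^2 (Euclidean norm) over u and v in C, which is then bounded below.
   If it is attained at (u, v), then w = v and w* = A u - v are as required, with k = 0.
   Otherwise take a minimizing sequence with u in a complement of {u | A u in Lsp(C)}: it is
   unbounded, and a cluster point u1 of the normalized sequence satisfies <g, u1> = 0, A u1 in C
   and A u1 not in Lsp(C). The cone C1 = T_C(A u1) inherits the penalty inequality, and Lsp(C1)
   contains Lsp(C) and A u1, so the iteration stops. If C were locally polyhedral near A u1, then
   C1 would be a polyhedral cone, on which the same iteration shows that the objective is attained;
   translating a minimizer over C1 far along (u1, A u1) brings it into C without changing the
   objective, and it would be a minimizer over C. *)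

(** * Bilinear form and max-norm estimates *)

Section Dot.
Variable R : realType.
Implicit Types n m : nat.

Lemma dotC n (x y : 'rV[R]_n) : dot x y = dot y x.
Proof. by apply: eq_bigr => i _; rewrite mulrC. Qed.

Lemma dotDr n (x y z : 'rV[R]_n) : dot x (y + z) = dot x y + dot x z.
Proof. by rewrite -big_split; apply: eq_bigr => i _; rewrite mxE mulrDr. Qed.

Lemma dotDl n (x y z : 'rV[R]_n) : dot (y + z) x = dot y x + dot z x.
Proof. by rewrite !(dotC _ x) dotDr. Qed.

Lemma dotZr n (x y : 'rV[R]_n) (a : R) : dot x (a *: y) = a * dot x y.
Proof. by rewrite mulr_sumr; apply: eq_bigr => i _; rewrite mxE mulrCA. Qed.

Lemma dotZl n (x y : 'rV[R]_n) (a : R) : dot (a *: x) y = a * dot x y.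
Proof. by rewrite dotC dotZr dotC. Qed.

Lemma dotNr n (x y : 'rV[R]_n) : dot x (- y) = - dot x y.
Proof. by rewrite -scaleN1r dotZr mulN1r. Qed.

Lemma dotNl n (x y : 'rV[R]_n) : dot (- x) y = - dot x y.
Proof. by rewrite dotC dotNr dotC. Qed.

Lemma dot0r n (x : 'rV[R]_n) : dot x 0 = 0.
Proof. by rewrite -(scale0r 0) dotZr mul0r. Qed.

Lemma dot0l n (x : 'rV[R]_n) : dot 0 x = 0.
Proof. by rewrite dotC dot0r. Qed.

Lemma dot_mulmx n m (w : 'rV[R]_m) (h : 'rV[R]_n) (B : 'M[R]_(n, m)) :
  dot w (h *m B) = dot (w *m B^T) h.
Proof.
rewrite /dot; under eq_bigr do rewrite mxE mulr_sumr.
rewrite exchange_big; apply: eq_bigr => i _.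
by rewrite mxE mulr_suml; apply: eq_bigr => j _; rewrite !mxE mulrA mulrAC.
Qed.

Lemma dot_delta n (x : 'rV[R]_n) (i : 'I_n) : dot x (delta_mx 0 i) = x 0 i.
Proof.
rewrite /dot (bigD1 i) //= mxE !eqxx mulr1 big1 ?addr0 // => j ji.
by rewrite mxE eqxx (negbTE ji) mulr0.
Qed.

Lemma dot_self_ge0 n (x : 'rV[R]_n) : 0 <= dot x x.
Proof. by apply: sumr_ge0 => i _; rewrite -expr2 sqr_ge0. Qed.

Lemma dot_self_eq0 n (x : 'rV[R]_n) : dot x x = 0 -> x = 0.
Proof.
move=> /eqP; rewrite psumr_eq0 => [/allP h|i _]; last by rewrite -expr2 sqr_ge0.
apply/rowP => i; apply/eqP; rewrite mxE.
by have := h i (mem_index_enum _); rewrite implyTb mulf_eq0 orbb.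
Qed.

Lemma row_entry_le n (x : 'rV[R]_n) (i : 'I_n) : `|x 0 i| <= `|x|.
Proof.
rewrite [leRHS]/Num.norm/= mx_normrE.
by apply: (@le_bigmax _ _ _ 0 (fun ij : 'I_1 * 'I_n => `|x ij.1 ij.2|) (0, i)).
Qed.

Lemma row_norm_le n (x : 'rV[R]_n) (c : R) :
  0 <= c -> (forall i, `|x 0 i| <= c) -> `|x| <= c.
Proof.
move=> c0 xc; rewrite [leLHS]/Num.norm/= mx_normrE.
by apply: bigmax_le => // -[i j] _ /=; rewrite ord1.
Qed.

Lemma dot_le n (x y : 'rV[R]_n) : `|dot x y| <= n%:R * `|x| * `|y|.
Proof.
rewrite (le_trans (ler_norm_sum _ _ _))//.
have -> : n%:R * `|x| * `|y| = \sum_(i < n) `|x| * `|y|.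
  by rewrite sumr_const card_ord -[RHS]mulr_natl mulrA.
by apply: ler_sum => i _; rewrite normrM ler_pM ?row_entry_le.
Qed.

Lemma sqr_norm_le_dot n (x : 'rV[R]_n) : `|x| ^+ 2 <= dot x x.
Proof.
rewrite -(sqr_sqrtr (dot_self_ge0 x)) ler_sqr ?nnegrE ?sqrtr_ge0//.
apply: row_norm_le => [|i]; first exact: sqrtr_ge0.
rewrite -sqrtr_sqr ler_wsqrtr// expr2 /dot (bigD1 i)//= lerDl.
by apply: sumr_ge0 => j _; rewrite -expr2 sqr_ge0.
Qed.

Lemma mulmx_bound n m (B : 'M[R]_(n, m)) :
  exists2 K : R, 0 < K & forall u : 'rV_n, `|u *m B| <= K * `|u|.
Proof.
have K0 : 0 <= n%:R * \sum_(j < m) `|(col j B)^T|.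
  by rewrite mulr_ge0// sumr_ge0.
exists (n%:R * (\sum_(j < m) `|(col j B)^T|) + 1) => [|u]; first lra.
apply: row_norm_le => [|j]; first by rewrite mulr_ge0//; lra.
have -> : (u *m B) 0 j = dot u (col j B)^T.
  by rewrite mxE; apply: eq_bigr => i _; rewrite !mxE.
rewrite (le_trans (dot_le _ _))// mulrAC ler_wpM2r//.
rewrite ler_wpDr// ler_wpM2l// (bigD1 j)//= lerDl.
by rewrite sumr_ge0.
Qed.

Lemma continuous_dot (T : topologicalType) n (f g : T -> 'rV[R]_n) :
  continuous f -> continuous g -> continuous (fun t => dot (f t) (g t)).
Proof.
move=> cf cg; rewrite /dot; apply: continuous_big => [|i _ t]; first exact: add_continuous.
apply: cvgM; apply: (@continuous_comp _ _ _ _ (fun M : 'rV[R]_n => M 0 i)).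
- exact: cf.
- exact: coord_continuous.
- exact: cg.
- exact: coord_continuous.
Qed.

Lemma continuous_mulmx (T : topologicalType) n m (f : T -> 'rV[R]_n) (B : 'M[R]_(n, m)) :
  continuous f -> continuous (fun t => f t *m B).
Proof.
move=> cf t; apply/cvgrPdist_lt => e e0.
have [K K0 BK] := mulmx_bound B.
have /cvgrPdist_lt/(_ (e / K)) := cf t; rewrite divr_gt0// => /(_ isT).
apply: filterS => x; rewrite ltr_pdivlMr// mulrC => h.
by rewrite -mulmxBl (le_lt_trans (BK _)).
Qed.

End Dot.

(** * Tangent cones of arbitrary sets *)

Section TangentCone.
Variables (R : realType) (n : nat).
Implicit Types (A C K : set 'rV[R]_n) (v w z : 'rV[R]_n).

Definition cone C := forall (a : R) x, 0 < a -> C x -> C (a *: x).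

Lemma tangent_coneP A z w :
  tangent_cone A z w <->
  A z /\ forall e : R, 0 < e -> exists t x, [/\ 0 < t < e, `|w - x| < e & A (z + t *: x)].
Proof.
split=> [[Az [t [x [t0 [tc [xc Ax]]]]]]|[Az h]]; split=> //.
  move=> e e0.
  have /cvgrPdist_lt/(_ e e0) tc' := tc; have /cvgrPdist_lt/(_ e e0) xc' := xc.
  have [k _ /(_ k (leqnn k)) [h1 h2]] := filterI tc' xc'.
  exists (t k), (x k); split => //.
  by rewrite t0/=; move: h1; rewrite sub0r normrN gtr0_norm.
have hk (k : nat) : exists p : R * 'rV[R]_n,
    [/\ 0 < p.1 < k.+1%:R^-1, `|w - p.2| < k.+1%:R^-1 & A (z + p.1 *: p.2)].
  by have [|t [x tx]] := h k.+1%:R^-1; [rewrite invr_gt0|exists (t, x)].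
have [p hp] := choice hk.
have small (e : R) : 0 < e -> \forall k \near \oo, k.+1%:R^-1 < e.
  by move=> e0; exact: (near_infty_natSinv_lt (PosNum e0)).
exists (fun k => (p k).1), (fun k => (p k).2); split; last split; last split.
- by move=> k; have [/andP[]] := hp k.
- apply/cvgrPdist_lt => e e0; apply: filterS (small e e0) => k ke.
  have [/andP[t0 te] _ _] := hp k.
  by rewrite sub0r normrN gtr0_norm// (lt_trans te).
- apply/cvgrPdist_lt => e e0; apply: filterS (small e e0) => k ke.
  by have [_ xe _] := hp k; rewrite (lt_trans xe).
- by move=> k; have [] := hp k.
Qed.

Lemma closed_epsP A :
  closed A <-> forall x, (forall e : R, 0 < e -> exists2 y, A y & `|x - y| < e) -> A x.
Proof.
split=> [cA x h|h x Ax].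
  apply: cA => U /nbhs_ballP[e /= e0 eU]; have [y Ay xy] := h e e0.
  by exists y; split => //; apply: eU; rewrite -ball_normE.
apply: h => e e0; have /Ax[y [Ay xy]] : nbhs x (ball x e) by exact: nbhsx_ballx.
by exists y => //; move: xy; rewrite -ball_normE.
Qed.

Lemma tangent_cone_closed A z : A z -> closed (tangent_cone A z).
Proof.
move=> Az; apply/closed_epsP => w h; apply/tangent_coneP; split => // e e0.
have e20 : 0 < e / 2 by rewrite divr_gt0.
have [y /tangent_coneP[_ /(_ _ e20)[t [x [/andP[t0 te] yx Ax]]]] wy] := h _ e20.
exists t, x; split => //; first by rewrite t0/=; lra.
by rewrite (le_lt_trans (ler_distD y _ _))//; lra.
Qed.

Lemma tangent_cone0 A z : A z -> tangent_cone A z 0.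
Proof.
move=> Az; apply/tangent_coneP; split=> // e e0.
exists (e / 2), 0; rewrite subrr normr0 scaler0 addr0; split => //.
by apply/andP; split; lra.
Qed.

Lemma tangent_cone_cone A z : cone (tangent_cone A z).
Proof.
move=> a w a0 /tangent_coneP[Az h]; apply/tangent_coneP; split=> // e e0.
have e'0 : 0 < Num.min (e * a) (e / a) by rewrite lt_min mulr_gt0//= divr_gt0.
have [t [x [/andP[t0]]]] := h _ e'0; rewrite !lt_min => /andP[te _] /andP[_ xe] Ax.
exists (t / a), (a *: x); split.
- by rewrite divr_gt0//= ltr_pdivrMr.
- by rewrite -scalerBr normrZ gtr0_norm// mulrC -ltr_pdivlMr.
- by rewrite scalerA divfK// gt_eqF.
Qed.

(** Adding [a *: l] to a direction [x] moves [v + t *: x] by a multiple of [l], along which [C] is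
    invariant. *)
Lemma tangent_cone_invariant C v l :
  (forall (a : R) c, C c -> C (c + a *: l)) ->
  forall (a : R) c, tangent_cone C v c -> tangent_cone C v (c + a *: l).
Proof.
move=> Cl a c /tangent_coneP[Cv h]; apply/tangent_coneP; split=> // e e0.
have [t [x [te xe Ax]]] := h e e0; exists t, (x + a *: l); split => //.
  by rewrite opprD addrACA subrr addr0.
by rewrite scalerDr addrA scalerA; exact: Cl.
Qed.

(* Scaling [v + t x] by [1 + t a] moves the direction [x] to [a v + (1 + t a) x]. *)
Lemma tangent_cone_cone_invariant C v : cone C ->
  forall (a : R) c, tangent_cone C v c -> tangent_cone C v (c + a *: v).
Proof.
move=> coneC a c /tangent_coneP[Cv h]; apply/tangent_coneP; split=> // e e0.
(* [M - 1] dominates both |a| and |a| |c|. The choice of [e'] then keeps t |a| below 1/2, so that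
   [1 + t * a] is positive, and the total error below [e]. *)
pose M := (1 + `|a|) * (1 + `|c|).
have M1 : 1 <= M by rewrite /M -[leLHS]mulr1 ler_pM// lerDl.
pose e' := Num.min 1 e / (2 * (M + 1)).
have me0 : 0 < Num.min 1 e by rewrite lt_min ltr01.
have M0 : 0 < 2 * (M + 1) by lra.
have e'0 : 0 < e' by rewrite divr_gt0.
have e'M : e' * (2 * (M + 1)) = Num.min 1 e by rewrite divfK// gt_eqF.
have [le1 lee] : Num.min 1 e <= 1 /\ Num.min 1 e <= e by rewrite !ge_min !lexx orbT.
have e'e : e' <= Num.min 1 e / 2 by rewrite ler_pdivlMr// -e'M ler_pM2l//; lra.
have [t [x [/andP[t0 te] xe Ax]]] := h e' e'0.
have aM : `|a| <= M - 1.
  have := mulr_ge0 (normr_ge0 a) (normr_ge0 c); have := normr_ge0 c.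
  by rewrite /M mulrDl mul1r mulrDr mulr1; lra.
have acM : `|a| * `|c| <= M - 1.
  by rewrite /M mulrDl mul1r mulrDr mulr1; have := normr_ge0 a; have := normr_ge0 c; lra.
have ta : t * `|a| < 1 / 2.
  have : t * `|a| <= e' * M by rewrite ler_pM ?(ltW t0) ?(ltW te)//; lra.
  by move: e'M; lra.
have ta1 : 0 < 1 + t * a.
  have : - (t * a) <= t * `|a| by rewrite -mulrN ler_pM2l// -normrN ler_norm.
  by lra.
exists t, (a *: v + (1 + t * a) *: x); split => //.
- by rewrite t0/=; lra.
- have -> : c + a *: v - (a *: v + (1 + t * a) *: x) =
            (1 + t * a) *: (c - x) - (t * a) *: c.
    by apply/rowP => i; rewrite !mxE; ring.
  have t1 : `|1 + t * a| <= 2.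
    by rewrite (le_trans (ler_normD _ _))// normr1 normrM gtr0_norm//; lra.
  have A1 : `|(1 + t * a) *: (c - x)| <= 2 * e'.
    by rewrite normrZ ler_pM// ltW.
  have A2 : `|(t * a) *: c| <= e' * (M - 1).
    by rewrite normrZ normrM (gtr0_norm t0) -mulrA ler_pM// ?ltW// mulr_ge0.
  rewrite (le_lt_trans (ler_normB _ _))//; move: e'M; lra.
- have -> : v + t *: (a *: v + (1 + t * a) *: x) = (1 + t * a) *: (v + t *: x).
    by apply/rowP => i; rewrite !mxE; ring.
  exact: coneC.
Qed.

(** Tangent vectors depend only on [A] near [v]; the cone property undoes the scaling by [t], and
    closedness of [K] absorbs the limit. *)
Lemma tangent_cone_local A K v :
  A v -> closed K -> cone K ->
  (exists2 r : R, 0 < r & forall x, `|x| < r -> A (v + x) <-> K x) -> tangent_cone A v = K.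
Proof.
move=> Av cK coneK [r r0 hr].
apply/seteqP; split => w.
- move=> /tangent_coneP[_ h]; move/closed_epsP: cK; apply => e e0.
  have W0 : 0 < `|w| + 1 by rewrite ltr_wpDl.
  have [|t [x [/andP[t0]]]] := h (Num.min e (Num.min 1 (r / (`|w| + 1)))).
    by rewrite !lt_min e0 ltr01 divr_gt0.
  rewrite !lt_min => /and3P[_ _ tr] /and3P[xe x1 _] Ax; exists x => //.
  have /hr : `|t *: x| < r.
    rewrite normrZ gtr0_norm//.
    have xw : `|x| <= `|w| + 1.
      have -> : x = w - (w - x) by rewrite opprB addrC subrK.
      by rewrite (le_trans (ler_normB _ _))// lerD2l ltW.
    move: tr; rewrite ltr_pdivlMr//; apply: le_lt_trans.
    by rewrite ler_pM2l.
  case=> /(_ Ax) Kx _.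
  have -> : x = t^-1 *: (t *: x) by rewrite scalerA mulVf ?scale1r ?gt_eqF.
  by apply: coneK; rewrite ?invr_gt0.
- move=> Kw; apply/tangent_coneP; split => // e e0.
  have W0 : 0 < `|w| + 1 by rewrite ltr_wpDl.
  have m0 : 0 < Num.min e (r / (`|w| + 1)) by rewrite lt_min e0 divr_gt0.
  have mlt : Num.min e (r / (`|w| + 1)) / 2 < Num.min e (r / (`|w| + 1)) by lra.
  exists (Num.min e (r / (`|w| + 1)) / 2), w; set t := _ / 2 in mlt *.
  have t0 : 0 < t by rewrite divr_gt0.
  move: mlt; rewrite lt_min => /andP[te tr].
  rewrite t0 te subrr normr0; split => //.
  apply/hr; last exact: coneK.
  rewrite normrZ gtr0_norm//; move: tr; rewrite ltr_pdivlMr//; apply: le_lt_trans.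
  by rewrite ler_pM2l// lerDl.
Qed.

End TangentCone.

(** * Polyhedral sets near one of their points *)

Section Polyhedral.
Variables (R : realType) (n : nat).
Implicit Types (C : set 'rV[R]_n) (v a : 'rV[R]_n) (P Q : 'rV[R]_n -> Prop).

Definition near_zero P := exists2 r : R, 0 < r & forall x, `|x| < r -> P x.

Lemma near_zero_imp P Q : (forall x, P x -> Q x) -> near_zero P -> near_zero Q.
Proof. by move=> PQ [r r0 h]; exists r => // x /h/PQ. Qed.

Lemma near_zero_and P Q : near_zero P -> near_zero Q -> near_zero (fun x => P x /\ Q x).
Proof.
move=> [r r0 Pr] [t t0 Qt]; exists (Num.min r t); first by rewrite lt_min r0.
by move=> x; rewrite lt_min => /andP[/Pr Px /Qt Qx].
Qed.

Lemma near_zero_all_ltn (N : nat) (P : nat -> 'rV[R]_n -> Prop) :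
  (forall i, (i < N)%N -> near_zero (P i)) ->
  near_zero (fun x => forall i, (i < N)%N -> P i x).
Proof.
elim: N => [_|N IH h]; first by exists 1.
have hN := IH (fun i iN => h i (ltnW iN)).
apply: near_zero_imp (near_zero_and hN (h N (ltnSn N))) => x [hx Nx] i.
by rewrite ltnS leq_eqVlt => /predU1P[->|/hx].
Qed.

Lemma near_zero_dot_lt a v (b : R) : dot a v < b -> near_zero (fun x => dot a (v + x) < b).
Proof.
move=> ab; have c0 : 0 < n%:R * `|a| + 1 by rewrite ltr_wpDl// mulr_ge0.
exists ((b - dot a v) / (n%:R * `|a| + 1)); first by rewrite divr_gt0// subr_gt0.
move=> x; rewrite ltr_pdivlMr// dotDr => xr.
have := le_trans (ler_norm _) (dot_le a x); have := normr_ge0 x; lra.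
Qed.

Lemma near_zero_dot_gt a v (b : R) : b < dot a v -> near_zero (fun x => b < dot a (v + x)).
Proof.
rewrite -ltrN2 -dotNl => /near_zero_dot_lt; apply: near_zero_imp => x.
by rewrite dotNl ltrN2.
Qed.

(** At a point outside, each of the finitely many pieces has a violated constraint, which stays
    violated nearby. *)
Lemma polyhedral_closed C : polyhedral C -> closed C.
Proof.
case=> N [M [a [b ->]]]; set C0 := [set x | _]; apply/closed_epsP => x hx.
apply: contrapT => nC.
have [r r0 hr] : near_zero (fun y => forall i, (i < N)%N ->
    ~ forall j, (j < M i)%N -> dot (a i j) (x + y) <= b i j).
  apply: near_zero_all_ltn => i iN.
  have [j [jM ab]] : exists j, (j < M i)%N /\ b i j < dot (a i j) x.
    apply: contrapT => hj; apply: nC; exists i; split => // j jM.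
    by rewrite leNgt; apply/negP => ab; apply: hj; exists j.
  apply: near_zero_imp (near_zero_dot_gt ab) => y hy /(_ j jM).
  by rewrite leNgt hy.
have [y [i [iN hi]] xy] := hx r r0.
by apply: (hr (y - x) _ i iN); rewrite 1?distrC// addrC subrK.
Qed.

(* Near [v] only the active constraints matter: inactive ones are replaced by [0 <= 0] and the
   pieces that do not contain [v] are made empty by a constraint [0 <= -1]. *)
Lemma locally_polyhedral_tangent C v : locally_polyhedral C v ->
  polyhedral (tangent_cone C v) /\ near_zero (fun x => C (v + x) <-> tangent_cone C v x).
Proof.
case=> Cv [W [/nbhs_ballP[r /= r0 rW] [Q [[N [M [a [b Qab]]]] CQ]]]].
have nW : near_zero (fun x => W (v + x)).
  exists r => // x xr; apply: rW.
  by rewrite -ball_normE /= opprD addrA subrr sub0r normrN.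
pose a' i j := if dot (a i j) v == b i j then a i j else 0.
pose b' i j : R := if dot (a i j) v <= b i j then 0 else -1.
pose K := [set x | exists i, (i < N)%N /\ forall j, (j < M i)%N -> dot (a' i j) x <= b' i j].
have pK : polyhedral K by exists N, M, a', b'.
have coneK : cone K.
  move=> c x c0 [i [iN hi]]; exists i; split => // j jM; have := hi j jM.
  rewrite dotZr /a' /b'; case: eqP => [->|_]; first by rewrite lexx pmulr_rle0.
  by rewrite dot0l mulr0.
have nK : near_zero (fun x => C (v + x) <-> K x).
  have n1 : near_zero (fun x => forall i, (i < N)%N -> forall j, (j < M i)%N ->
      (dot (a i j) v < b i j -> dot (a i j) (v + x) < b i j) /\
      (b i j < dot (a i j) v -> b i j < dot (a i j) (v + x))).
    apply: near_zero_all_ltn => i iN; apply: near_zero_all_ltn => j jM; apply: near_zero_and.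
      have [ab|ab] := ltP (dot (a i j) v) (b i j); last by exists 1.
      by apply: near_zero_imp (near_zero_dot_lt ab).
    have [ab|ab] := ltP (b i j) (dot (a i j) v); last by exists 1.
    by apply: near_zero_imp (near_zero_dot_gt ab).
  apply: near_zero_imp (near_zero_and n1 nW) => x [hx Wx].
  have -> : C (v + x) <-> Q (v + x).
    split=> h.
      by have : (C `&` W) (v + x) by []; rewrite CQ => -[].
    by have : (Q `&` W) (v + x) by []; rewrite -CQ => -[].
  rewrite Qab; split => -[i [iN hi]]; exists i; split => // j jM.
  - have := hi j jM; have [h1 h2] := hx i iN j jM; rewrite /a' /b' dotDr.
    case: (ltgtP (dot (a i j) v) (b i j)) => h.
    + by rewrite dot0l.
    + by move: (h2 h); rewrite dotDr ltNge => /negP.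
    + by rewrite h gerDl.
  - have := hi j jM; have [h1 h2] := hx i iN j jM; rewrite /a' /b' dotDr.
    case: (ltgtP (dot (a i j) v) (b i j)) => h.
    + by move=> _; rewrite -dotDr ltW// h1.
    + by rewrite dot0l; lra.
    + by rewrite h gerDl.
(* [K] is a closed cone that agrees near 0 with [C] translated by [- v], so it is the tangent
   cone. *)
by rewrite (tangent_cone_local Cv (polyhedral_closed pK) coneK nK).
Qed.

Lemma polyhedral_locally C v : polyhedral C -> C v -> locally_polyhedral C v.
Proof. by move=> pC Cv; split => //; exists setT; split; [exact: filterT|exists C]. Qed.

End Polyhedral.

(** * Compactness and cluster points *)

Section Compactness.
Variables (R : realType) (n : nat).

Lemma compact_bounded_row (C : set 'rV[R]_n) (r : R) :
  closed C -> compact [set x | `|x| <= r /\ C x].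
Proof.
move=> cC; apply: bounded_closed_compact.
  by exists r; split; [exact: num_real|move=> M rM x [xr _]; exact: le_trans xr (ltW rM)].
apply/closed_epsP => x hx; split.
  apply/ler_addgt0Pr => e e0; have [y [yr _] xy] := hx e e0.
  have -> : x = y + (x - y) by rewrite addrC subrK.
  by rewrite (le_trans (ler_normD _ _))// lerD// ltW.
by move/closed_epsP: cC; apply => e /hx[y [_ Cy] xy]; exists y.
Qed.

Lemma bounded_seq_cluster (x : nat -> 'rV[R]_n) (r : R) : (forall k, `|x k| <= r) ->
  exists p, forall (e : R) N, 0 < e -> exists2 k, (N <= k)%N & `|p - x k| < e.
Proof.
move=> xr; have cA := @compact_bounded_row setT r (@closedT _).
have [|p [_ clp]] := cA (x @ \oo) _; first by exists 0%N => // k _; split.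
exists p => e N e0.
have [||_ [[k Nk <-]]] := clp (x @` [set k | (N <= k)%N]) (ball p e).
- by exists N => // k Nk; exists k.
- exact: nbhsx_ballx.
by rewrite -ball_normE; exists k.
Qed.

Lemma norm_eps_eq0 (V : normedModType R) (z : V) (c : R) :
  (forall e : R, 0 < e <= 1 -> `|z| <= c * e) -> z = 0.
Proof.
move=> h; apply/eqP; rewrite -normr_eq0 eq_le normr_ge0 andbT leNgt; apply/negP => z0.
have c0 : 0 < c by have := h 1; rewrite ltr01 lexx => /(_ isT); lra.
have := h (Num.min 1 (`|z| / (2 * c))).
rewrite lt_min ltr01 divr_gt0 ?mulr_gt0//= ge_min lexx => /(_ isT).
have : c * Num.min 1 (`|z| / (2 * c)) <= c * (`|z| / (2 * c)).
  by rewrite ler_pM2l// ge_min lexx orbT.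
have -> : c * (`|z| / (2 * c)) = `|z| / 2 by field; rewrite gt_eqF.
lra.
Qed.

End Compactness.

(** * The penalized objective and its first-order conditions *)

Section Penalty.
Variables (R : realType) (d s : nat) (B : 'M[R]_(d, s)) (g : 'rV[R]_d).
Implicit Types (C : set 'rV[R]_s) (u : 'rV[R]_d) (v : 'rV[R]_s).

(** The factor 2 makes the gradient in [u] equal to 2 (g + (u B - v) B^T), so the residual
    [u *m B - v] itself can serve as multiplier. *)
Definition obj u v : R := 2 * dot g u + dot (u *m B - v) (u *m B - v).

Definition attained C := exists u v, C v /\ forall u' v', C v' -> obj u v <= obj u' v'.

Definition exact_penalty C (L : R) :=
  0 <= L /\ forall u v, C v -> 0 <= dot g u + L * `|u *m B - v|.

(** The square penalty dominates the linear one; this bounds the objective below, and the residual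
    on sublevel sets. *)
Lemma obj_gap C L u v : exact_penalty C L -> C v ->
  `|u *m B - v| ^+ 2 - 2 * L * `|u *m B - v| <= obj u v.
Proof.
move=> [_ h] Cv; have := h u v Cv; have := sqr_norm_le_dot (u *m B - v).
by rewrite /obj; lra.
Qed.

Lemma linear_sqr_ge0_eq0 (a b : R) : (forall t, 0 <= a * t + b * t ^+ 2) -> a = 0.
Proof.
move=> h; apply/eqP; rewrite -normr_eq0; apply/eqP.
have b1 : 0 < `|b| + 1 by rewrite ltr_wpDl.
have := h (- a / (`|b| + 1)); have := ler_norm b.
have -> : a * (- a / (`|b| + 1)) + b * (- a / (`|b| + 1)) ^+ 2 =
  (b - `|b| - 1) * (a / (`|b| + 1)) ^+ 2 by field; rewrite gt_eqF.
move=> bb; rewrite nmulr_rge0; last by lra.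
move=> h2; have : (a / (`|b| + 1)) ^+ 2 = 0 by apply/eqP; rewrite eq_le h2 sqr_ge0.
move/eqP; rewrite sqrf_eq0 mulf_eq0 invr_eq0 (gt_eqF b1) orbF => /eqP ->.
by rewrite normr0.
Qed.

Lemma dot_subZ v w (t : R) :
  dot (v - t *: w) (v - t *: w) = dot v v - 2 * t * dot v w + t ^+ 2 * dot w w.
Proof. by rewrite !(dotDl, dotDr, dotNl, dotNr, dotZl, dotZr) (dotC w v); ring. Qed.

Lemma objDr u v h : obj (u + h) v =
  obj u v + 2 * dot (g + (u *m B - v) *m B^T) h + dot (h *m B) (h *m B).
Proof.
rewrite /obj (mulmxDl u h) (addrAC (u *m B)); move: (u *m B - v) => p.
rewrite !(dotDr, dotDl) -(dot_mulmx p h B) (dotC (h *m B) p); lra.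
Qed.

(** Variation of [v] within [C] makes the residual normal to [C]; free variation of [u] gives the
    equation. *)
Lemma attained_multiplier C : attained C ->
  exists w ws, [/\ C w, normal_cone C w ws & g + ws *m B^T = 0].
Proof.
move=> [u [v [Cv opt]]]; exists v, (u *m B - v); split => //.
  split=> // w /tangent_coneP[_ h]; rewrite leNgt; apply/negP => p0.
  set p := u *m B - v in p0.
  (* Moving [v] by [t *: x] changes the objective by t (t <x, x> - 2 <p, x>). The terms of [c]
     control <x, x> and 2 (<p, w> - <p, x>), so this is negative once [t] and |w - x| are below <p,
     w> / c. *)
  pose c := s%:R * `|p| * 2 + s%:R * (`|w| + 1) * (`|w| + 1) + 1.
  have c0 : 0 < c by rewrite /c ltr_wpDl// addr_ge0// !mulr_ge0// addr_ge0.
  have e0 : 0 < Num.min 1 (dot p w / c) by rewrite lt_min ltr01 divr_gt0.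
  have [t [x [/andP[t0]]]] := h _ e0.
  rewrite !lt_min !ltr_pdivlMr// => /andP[t1 tc] /andP[x1 xc] Cx.
  have := opt u _ Cx; rewrite /obj opprD addrA -/p.
  rewrite dot_subZ.
  have xw : `|x| <= `|w| + 1.
    have -> : x = w - (w - x) by rewrite opprB addrC subrK.
    by rewrite (le_trans (ler_normB _ _))// lerD2l ltW.
  have xx : dot x x <= s%:R * (`|w| + 1) * (`|w| + 1).
    rewrite (le_trans (ler_norm _))// (le_trans (dot_le _ _))//.
    by rewrite ler_pM ?mulr_ge0// ler_wpM2l.
  have px : dot p w - dot p x <= s%:R * `|p| * `|w - x|.
    by rewrite -dotNr -dotDr (le_trans (ler_norm _))// dot_le.
  move=> q; have {}q : 0 <= t * (t * dot x x - 2 * dot p x) by lra.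
  rewrite pmulr_rge0// in q.
  have tx : t * dot x x <= t * (s%:R * (`|w| + 1) * (`|w| + 1)) by rewrite ler_pM2l.
  have A0 : 0 <= s%:R * `|p| by rewrite mulr_ge0.
  have B0 : 0 <= s%:R * (`|w| + 1) * (`|w| + 1) by rewrite !mulr_ge0// addr_ge0.
  have C0 := mulr_ge0 A0 (normr_ge0 (w - x)).
  have D0 := mulr_ge0 B0 (ltW t0); have E0 := mulr_ge0 A0 (ltW t0).
  have F0 := mulr_ge0 B0 (normr_ge0 (w - x)).
  rewrite /c in tc xc; have := normr_ge0 (w - x); lra.
apply: dot_self_eq0; set z := g + _.
suff : 2 * dot z z = 0 by lra.
apply: (@linear_sqr_ge0_eq0 _ (dot (z *m B) (z *m B))) => t.
have := opt (u + t *: z) v Cv.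
rewrite objDr -scalemxAl !dotZr !dotZl -/z; lra.
Qed.

Lemma obj_shift u v u1 (t : R) : dot g u1 = 0 ->
  obj (u + t *: u1) (v + t *: (u1 *m B)) = obj u v.
Proof.
move=> gu; rewrite /obj dotDr dotZr gu mulr0 addr0 mulmxDl -scalemxAl opprD addrACA.
by rewrite subrr addr0.
Qed.

End Penalty.

(** * Minimizing sequences and recession directions *)

Section Recession.
Variables (R : realType) (d s : nat) (B : 'M[R]_(d, s)) (g : 'rV[R]_d).
Variables (C : set 'rV[R]_s) (L : R) (pi : 'M[R]_d).
Hypotheses (cC : closed C) (C0 : C 0) (coneC : cone C) (penC : exact_penalty B g C L).
Hypotheses (pi_idem : pi *m pi = pi) (pi_obj : forall u, dot g (u - u *m pi) = 0).
Hypothesis pi_cone : forall u v, C v -> C (v - (u - u *m pi) *m B).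

Let E := [set e | exists u v, C v /\ obj B g u v = e].

Lemma obj_has_inf : has_inf E.
Proof.
split; first by exists (obj B g 0 0), 0, 0.
exists (- L ^+ 2) => _ [u [v [Cv <-]]].
rewrite (le_trans _ (obj_gap _ penC Cv))//.
have := sqr_ge0 (`|u *m B - v| - L); rewrite sqrrB; lra.
Qed.

Lemma inf_obj_le u v : C v -> inf E <= obj B g u v.
Proof. by move=> Cv; apply: ge_inf; [exact: obj_has_inf.2|exists u, v]. Qed.

(** The discarded part [u - u *m pi] is annihilated by [g], and subtracting its image from [v]
    preserves both [C] and the residual; so minimizing sequences can be kept in the range of
    [pi]. *)
Lemma near_minimizer (e : R) : 0 < e ->
  exists u v, [/\ C v, u *m pi = u & obj B g u v < inf E + e].
Proof.
move=> e0; have [_ [u [v [Cv <-]]] ue] := inf_adherent e0 obj_has_inf.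
exists (u *m pi), (v - (u - u *m pi) *m B); split; first exact: pi_cone.
  by rewrite -mulmxA pi_idem.
suff -> : obj B g (u *m pi) (v - (u - u *m pi) *m B) = obj B g u v by [].
have gu : dot g (u *m pi) = dot g u.
  by have := pi_obj u; rewrite dotDr dotNr => /eqP; rewrite subr_eq0 => /eqP.
rewrite /obj gu mulmxBl.
have -> // : u *m pi *m B - (v - (u *m B - u *m pi *m B)) = u *m B - v.
by apply/rowP => i; rewrite !(mxE _ _ 0 i); ring.
Qed.

(** For x > [gap], x^2 - 2 L x exceeds [inf E + 1], so [obj_gap] rules out such a residual near the
    infimum. *)
Let gap := 2 * L + `|inf E| + 2.

Lemma near_minimizer_gap u v : C v -> obj B g u v <= inf E + 1 -> `|u *m B - v| <= gap.
Proof.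
move=> Cv /(le_trans (obj_gap _ penC Cv)) h; rewrite leNgt; apply/negP => hlt.
have := ler_norm (inf E); have := normr_ge0 (inf E); have L0 := penC.1.
move: hlt h; rewrite /gap; move: (inf E) `|inf E| `|_ - _| => m m' x; nra.
Qed.

(** Bounded [u] and bounded residual give bounded [v], so near-minimizers lie in a compact set, on
    which the continuous objective has a minimum. *)
Lemma bounded_attained (r : R) :
  (forall e : R, 0 < e -> exists u v, [/\ C v, `|u| <= r & obj B g u v < inf E + e]) ->
  attained B g C.
Proof.
move=> h; have [K K0 hK] := mulmx_bound B.
pose S := [set x : 'rV[R]_d | `|x| <= r /\ setT x] `*`
          [set y : 'rV[R]_s | `|y| <= K * r + gap /\ C y].
have cS : compact S by apply: compact_setX; exact: compact_bounded_row.
have inS u v : C v -> `|u| <= r -> obj B g u v <= inf E + 1 -> S (u, v).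
  move=> Cv ur uv; do 2![split => //=].
  have -> : v = u *m B - (u *m B - v) by rewrite opprB addrC subrK.
  rewrite (le_trans (ler_normB _ _))// lerD ?near_minimizer_gap//.
  by rewrite (le_trans (hK _))// ler_pM2l.
have S0 : S !=set0.
  by have [u [v [Cv ur /ltW uv]]] := h 1 ltr01; exists (u, v); exact: inS.
have co : continuous (fun p : 'rV[R]_d * 'rV[R]_s => obj B g p.1 p.2).
  have c1 : continuous (@fst 'rV[R]_d 'rV[R]_s) by move=> p; exact: cvg_fst.
  have c2 : continuous (@snd 'rV[R]_d 'rV[R]_s) by move=> p; exact: cvg_snd.
  have cb : continuous (fun p : 'rV[R]_d * 'rV[R]_s => p.1 *m B - p.2).
    move=> p; apply: cvgB; [exact: (continuous_mulmx c1)|exact: c2].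
  move=> p; apply: cvgD; last exact: (continuous_dot cb cb).
  apply: cvgM; first exact: cvg_cst.
  by apply: (continuous_dot (f := fun=> g) _ c1); exact: cst_continuous.
have [[u v] uvS uvmin] := compact_EVT_min S0 cS (continuous_subspaceT co).
rewrite inE in uvS; case: uvS => _ [_ /= Cv].
exists u, v; split=> // u' v' Cv'; apply: le_trans (inf_obj_le u' Cv').
apply/ler_addgt0Pr => e e0.
have m0 : 0 < Num.min 1 e by rewrite lt_min ltr01.
have [u2 [v2 [Cv2 u2r h2]]] := h _ m0.
have mle : Num.min 1 e <= 1 /\ Num.min 1 e <= e by rewrite !ge_min !lexx orbT.
have /mem_set/uvmin /= : S (u2, v2) by apply: inS => //; lra.
lra.
Qed.

(* If the infimum is not attained, minimizing sequences in the range of [pi] are unbounded;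
   [u1] is a cluster point of the normalized sequence. *)
Lemma unattained_recession : ~ attained B g C ->
  exists u1, [/\ u1 != 0, u1 *m pi = u1, dot g u1 = 0, C (u1 *m B) &
    forall (e : R) u0 v0, 0 < e -> C v0 -> exists u v t,
      [/\ C v, obj B g u v <= obj B g u0 v0 + e, 0 < t & `|u1 *m B - t *: v| < e]].
Proof.
move=> notatt.
(* If, for some [k], all such near-minimizers in the range of [pi] had norm at most k + 1,
   [bounded_attained] would apply. *)
have far (k : nat) : exists p : 'rV[R]_d * 'rV[R]_s,
    [/\ C p.2, p.1 *m pi = p.1, k.+1%:R < `|p.1| & obj B g p.1 p.2 < inf E + k.+1%:R^-1].
  apply: contrapT => nf; apply: notatt; apply: (@bounded_attained k.+1%:R) => e e0.
  have m0 : 0 < Num.min e k.+1%:R^-1 by rewrite lt_min e0 invr_gt0 ltr0n.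
  have [u [v [Cv pu]]] := near_minimizer m0.
  rewrite -ltrBlDl lt_min !ltrBlDl => /andP[h1 h2]; exists u, v; split=> //.
  by rewrite leNgt; apply/negP => ku; apply: nf; exists (u, v).
have [p hp] := choice far.
have xk0 k : 0 < `|(p k).1| by have [_ _ h _] := hp k; rewrite (lt_trans _ h)// ltr0n.
pose x k := `|(p k).1|^-1 *: (p k).1.
have x1 k : `|x k| = 1 by rewrite normrZ normfV normr_id mulVf// gt_eqF.
have [u1 hu1] := bounded_seq_cluster (fun k => eq_ind_r (fun a => a <= 1) (lexx 1) (x1 k)).
have [K K0 hK] := mulmx_bound B.
have [K' K'0 hK'] := mulmx_bound pi.
(* Bounds |2 <g, u>| along the sequence: the objective lies between [inf E] and [inf E + 1], and the
   squared residual below s gap^2. *)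
pose Gam := `|inf E| + 1 + s%:R * gap * gap.
have gap0 : 0 <= gap by rewrite /gap; have := penC.1; have := normr_ge0 (inf E); lra.
have key (e : R) : 0 < e <= 1 -> exists u v t, [/\ C v, obj B g u v < inf E + e,
    0 < t < e, `|u1 - t *: u| < e & [/\ u *m pi = u, `|u *m B - v| <= gap & `|2 * dot g u| <= Gam]].
  move=> /andP[e0 e1].
  have [N _ hN] := near_infty_natSinv_lt (PosNum e0).
  have [k Nk u1k] := hu1 e N e0.
  have [Cv pu ku ov] := hp k; exists (p k).1, (p k).2, `|(p k).1|^-1.
  have ke : k.+1%:R^-1 < e := hN k Nk.
  have ove : obj B g (p k).1 (p k).2 < inf E + e by rewrite (lt_trans ov)// ltrD2l.
  have gp : `|(p k).1 *m B - (p k).2| <= gap by apply: near_minimizer_gap => //; lra.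
  split => //.
    by rewrite invr_gt0 xk0 (lt_trans _ ke)// ltf_pV2// ?posrE// ltr0n.
  split => //; have := inf_obj_le (p k).1 Cv; move: ove; rewrite /obj.
  have /andP[n1 n2] : - `|inf E| <= inf E <= `|inf E| by rewrite -ler_norml.
  have q1 : dot ((p k).1 *m B - (p k).2) ((p k).1 *m B - (p k).2) <= s%:R * gap * gap.
    rewrite (le_trans (ler_norm _))// (le_trans (dot_le _ _))//.
    by rewrite ler_pM ?mulr_ge0// ler_wpM2l.
  have := dot_self_ge0 ((p k).1 *m B - (p k).2).
  rewrite ler_norml /Gam => *; apply/andP; split; lra.
have rec (e : R) u0 v0 : 0 < e -> C v0 -> exists u v t,
    [/\ C v, obj B g u v <= obj B g u0 v0 + e, 0 < t & `|u1 *m B - t *: v| < e].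
  (* u1 B - t v splits as (u1 - t u) B + t (u B - v), each part being small; [c] collects their two
     constants. *)
  move=> e0 Cv0; pose c := K + gap + 1.
  have c0 : 0 < c by rewrite /c; lra.
  have m0 : 0 < Num.min e (Num.min 1 (e / c)) by rewrite !lt_min e0 ltr01 divr_gt0.
  have [le1 le2 le3] : [/\ Num.min e (Num.min 1 (e / c)) <= e,
      Num.min e (Num.min 1 (e / c)) <= 1 & Num.min e (Num.min 1 (e / c)) <= e / c].
    by rewrite !ge_min !lexx !orbT.
  set m := Num.min _ _ in m0 le1 le2 le3.
  have [|u [v [t [Cv ov /andP[t0 te] u1t [_ gp _]]]]] := key m; first by rewrite m0.
  exists u, v, t; split => //.
    by have := inf_obj_le u0 Cv0; lra.
  have -> : u1 *m B - t *: v = (u1 - t *: u) *m B + t *: (u *m B - v).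
    by rewrite mulmxBl scalerBr -scalemxAl addrA subrK.
  rewrite (le_lt_trans (ler_normD _ _))// normrZ (gtr0_norm t0).
  have A1 := hK (u1 - t *: u).
  have A2 : K * `|u1 - t *: u| <= K * m by rewrite ler_pM2l// ltW.
  have A3 : t * `|u *m B - v| <= m * gap by rewrite ler_pM// ltW.
  move: le3; rewrite ler_pdivlMr// /c; lra.
exists u1; split => //.
- apply/eqP => u10; have [k _] := hu1 1 0%N ltr01.
  by rewrite u10 sub0r normrN x1 ltxx.
- apply/eqP; rewrite -subr_eq0; apply/eqP; apply: (norm_eps_eq0 (c := K' + 1)) => e e01.
  have [u [v [t [_ _ _ u1t [pu _ _]]]]] := key e e01.
  have -> : u1 *m pi - u1 = (u1 - t *: u) *m pi - (u1 - t *: u).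
    by rewrite mulmxBl -scalemxAl pu opprB addrA subrK.
  rewrite (le_trans (ler_normB _ _))// mulrDl mul1r lerD//; last exact: ltW.
  by rewrite (le_trans (hK' _))// ler_pM2l// ltW.
(* <g, u> stays bounded along the sequence while [t] tends to 0. *)
- apply: (@norm_eps_eq0 _ R^o _ (d%:R * `|g| + Gam)) => e e01.
  have [u [v [t [_ _ /andP[t0 te] u1t [_ _ gu]]]]] := key e e01.
  have -> : dot g u1 = dot g (u1 - t *: u) + t * dot g u.
    by rewrite dotDr dotNr dotZr subrK.
  rewrite (le_trans (ler_normD _ _))// mulrDl lerD//.
    by rewrite (le_trans (dot_le _ _))// ler_wpM2l ?mulr_ge0// ltW.
  rewrite normrM (gtr0_norm t0) mulrC ler_pM//; [exact: ltW| |exact: ltW].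
  move: gu; rewrite normrM gtr0_norm//; have := normr_ge0 (dot g u); lra.
- move/closed_epsP: cC; apply => e e0.
  have [u [v [t [Cv _ t0 ut]]]] := rec e 0 0 e0 C0.
  by exists (t *: v) => //; exact: coneC.
Qed.

End Recession.

(** * Iterated tangent cones and termination *)

Section Induction.
Variables (R : realType) (d s : nat) (B : 'M[R]_(d, s)) (g : 'rV[R]_d) (L : R).
Implicit Types (C : set 'rV[R]_s) (M : 'M[R]_s).

(** The class of cones preserved by the iteration, with the same constant [L] throughout. *)
Definition admissible C := [/\ closed C, C 0, cone C & exact_penalty B g C L].

(** An invariance subspace is encoded as a row space, so that its dimension is a rank. *)
Definition inv_mx C M := forall c l, C c -> (l <= M)%MS -> C (c + l).

Lemma inv_mx_adds C M (v : 'rV[R]_s) : inv_mx C M -> (forall (a : R) c, C c -> C (c + a *: v)) ->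
  inv_mx C (M + v)%MS.
Proof.
move=> iM iv c l Cc /sub_addsmxP[[D1 D2] /= ->].
rewrite (mx11_scalar D2) mul_scalar_mx addrA; apply: (iv); apply: iM => //.
exact: submxMl.
Qed.

Lemma inv_mx_Lsp C M0 : inv_mx C M0 -> exists M,
  [/\ inv_mx C M, (\rank M0 <= \rank M)%N & forall v, Lsp C v -> (v <= M)%MS].
Proof.
move=> iM0; pose P k := `[< exists2 M, inv_mx C M & \rank M = k >].
have exP : exists k, P k by exists (\rank M0); apply/asboolP; exists M0.
have ubP k : P k -> (k <= s)%N by move=> /asboolP[M _ <-]; exact: rank_leq_row.
case: (ex_maxnP exP ubP) => k /asboolP[M iM rM] maxk; exists M; split => //.
  by rewrite rM; apply: maxk; apply/asboolP; exists M0.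
move=> v [S [[S0 [SD SZ]] [CS Sv]]].
have iMv : inv_mx C (M + v)%MS.
  by apply: inv_mx_adds => // a c Cc; apply: CS => //; exact: SZ.
have : (\rank (M + v)%MS <= k)%N by apply: maxk; apply/asboolP; exists (M + v)%MS.
rewrite -rM (geq_leqif (mxrank_leqif_sup (addsmxSl M v))).
by apply: submx_trans; exact: addsmxSr.
Qed.

(** Since <g, u1> = 0, the penalty inequality at [u1 + t *: u] and [u1 *m B + t *: x] can be divided
    by [t]. *)
Lemma tangent_admissible C u1 : admissible C -> C (u1 *m B) -> dot g u1 = 0 ->
  admissible (tangent_cone C (u1 *m B)).
Proof.
move=> [cC C0 coneC [L0 pen]] C1 g1; split.
- exact: tangent_cone_closed.
- exact: tangent_cone0.
- exact: tangent_cone_cone.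
split=> // u v /tangent_coneP[_ h]; apply/ler_addgt0Pr => e e0.
have L1 : 0 < L + 1 by rewrite ltr_wpDl.
have [|t [x [/andP[t0 _] vx Cx]]] := h (e / (L + 1)); first by rewrite divr_gt0.
have := pen (u1 + t *: u) _ Cx.
rewrite dotDr dotZr g1 add0r mulmxDl -scalemxAl opprD addrACA subrr add0r -scalerBr normrZ.
rewrite (gtr0_norm t0) mulrCA -mulrDr pmulr_rge0// => /le_trans; apply.
rewrite -addrA lerD2l.
have uvx : `|u *m B - x| <= `|u *m B - v| + `|v - x| by exact: ler_distD.
have : L * `|v - x| <= e.
  have -> : e = (L + 1) * (e / (L + 1)) by rewrite mulrC divfK// gt_eqF.
  by rewrite ler_pM ?lerDl//; exact: ltW.
have := ler_wpM2l L0 uvx; lra.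
Qed.

(** One iteration. The tangent cone keeps the invariance of [C] and gains the direction [u1 *m B]
    outside [Lsp C], so the rank grows. The last clause returns attainment to [C] when the two cones
    agree locally. *)
Lemma recession_step C M0 : admissible C -> inv_mx C M0 -> ~ attained B g C ->
  exists u1 M1, let C1 := tangent_cone C (u1 *m B) in
    [/\ [/\ C (u1 *m B), ~ Lsp C (u1 *m B) & dot g u1 = 0],
        admissible C1, inv_mx C1 M1, (\rank M0 < \rank M1)%N &
        near_zero (fun x => C (u1 *m B + x) <-> C1 x) -> attained B g C1 -> attained B g C].
Proof.
move=> adC iM0 natt; have [cC C0 coneC penC] := adC.
have [M [iM r0M LM]] := inv_mx_Lsp iM0.
(* [N] consists of the [u] with [u *m B] in the row space of [M]; [pi] projects along [N] onto a
   complement. *)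
pose N := kermx (B *m cokermx M); pose pi := proj_mx (N^C)%MS N.
have NP u : (u <= N)%MS = (u *m B <= M)%MS.
  by rewrite sub_kermx mulmxA -submxE.
have dx : ((N^C)%MS :&: N = 0)%MS by rewrite capmxC capmx_compl.
have pi_sub (u : 'rV_d) : ((u - u *m pi) *m B <= M)%MS.
  rewrite -NP; apply: proj_mx_compl_sub; rewrite addsmxC.
  by apply: submx_full; exact: addsmx_compl_full.
have C_sub v : (v <= M)%MS -> C v by move=> vM; rewrite -[v]add0r; exact: iM.
(* A direction in [N] and its opposite are both sent into [C], so the penalty inequality with zero
   residual gives both signs. *)
have pi_obj u : dot g (u - u *m pi) = 0.
  apply/eqP; rewrite eq_le; apply/andP; split.
    have := penC.2 (- (u - u *m pi)) (- (u - u *m pi) *m B).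
    rewrite subrr normr0 mulr0 addr0 dotNr oppr_ge0; apply.
    by apply: C_sub; rewrite mulNmx eqmx_opp.
  have := penC.2 (u - u *m pi) ((u - u *m pi) *m B).
  by rewrite subrr normr0 mulr0 addr0; apply; exact: C_sub.
have pi_cone u v : C v -> C (v - (u - u *m pi) *m B).
  by move=> Cv; apply: iM => //; rewrite eqmx_opp.
have [u1 [u10 u1pi g1 C1 rec]] :=
  unattained_recession cC C0 coneC penC (proj_mx_proj dx) pi_obj pi_cone natt.
(* [pi] vanishes on [N] but fixes the nonzero [u1]. *)
have nM : ~~ (u1 *m B <= M)%MS.
  rewrite -NP; apply/negP => /(proj_mx_0 dx) p0.
  by move: u10; rewrite -u1pi /pi p0 eqxx.
have v1_inv := @tangent_cone_cone_invariant R s C (u1 *m B) coneC.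
exists u1, (M + u1 *m B)%MS; split => //.
- by split => // /LM; apply/negP.
- exact: tangent_admissible.
- apply: inv_mx_adds; last exact: v1_inv.
  move=> c l Cc lM; rewrite -[l]scale1r; apply: tangent_cone_invariant => // a c' Cc'.
  by apply: iM => //; exact: scalemx_sub.
- rewrite (leq_ltn_trans r0M)// (ltn_leqif (mxrank_leqif_sup (addsmxSl M _))).
  by rewrite addsmx_sub submx_refl.
move=> [r r0 loc] [u [v [Cv opt]]].
(* A competitor in [C] is matched up to [e] by a pair whose rescaled [v'] is near [u1 *m B]. Then
   [v'] lies in the tangent cone, which is invariant along [u1 *m B], and the minimizer there can be
   compared with it. *)
have opt' u0 v0 : C v0 -> obj B g u v <= obj B g u0 v0.
  move=> Cv0; apply/ler_addgt0Pr => e e0.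
  have m0 : 0 < Num.min e r by rewrite lt_min e0.
  have [u' [v' [t [Cv' ov' t0]]]] := rec _ u0 v0 m0 Cv0.
  rewrite lt_min => /andP[_ v1r].
  have me : Num.min e r <= e by rewrite ge_min lexx.
  suff /(opt u') : tangent_cone C (u1 *m B) v' by lra.
  have -> : v' = t^-1 *: ((t *: v' - u1 *m B) + 1 *: (u1 *m B)).
    by rewrite scale1r subrK scalerA mulVf ?scale1r// gt_eqF.
  apply: tangent_cone_cone; first by rewrite invr_gt0.
  apply: v1_inv; apply/loc; first by rewrite distrC.
  by rewrite addrC subrK; exact: coneC.
(* [tau] makes |v| / tau smaller than [r], so the translated point is a multiple of one in the ball
   where [loc] applies. *)
pose tau := (`|v| + 1) / r.
have tau0 : 0 < tau by rewrite divr_gt0// ltr_wpDl.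
exists (u + tau *: u1), (v + tau *: (u1 *m B)); split.
  have -> : v + tau *: (u1 *m B) = tau *: (u1 *m B + tau^-1 *: v).
    by rewrite scalerDr scalerA divff ?gt_eqF// scale1r addrC.
  apply: coneC => //; apply/loc.
    rewrite normrZ gtr0_norm ?invr_gt0// invf_div mulrAC ltr_pdivrMr ?ltr_wpDl//.
    by rewrite ltr_pM2l// ltrDl.
  by apply: tangent_cone_cone => //; rewrite invr_gt0.
by move=> u' v' /opt'; rewrite obj_shift.
Qed.

(** A polyhedral set agrees locally with its tangent cones, which are again polyhedral, so
    attainment always passes back; the growing rank ends the recursion. *)
Lemma polyhedral_attained C M : admissible C -> inv_mx C M -> polyhedral C -> attained B g C.
Proof.
move=> aC iM pC.
(* [k] exceeds the codimension of [M], so the case 0 is impossible. *)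
have [k] : exists k, (s < k + \rank M)%N by exists s.+1; rewrite addSn ltnS leq_addr.
elim: k C M aC iM pC => [|k IH] C M aC iM pC kM.
  by have := rank_leq_row M; rewrite leqNgt kM.
apply: contrapT => natt.
have [u1 [M1 [[C1 _ _] aC1 iM1 rM1 esc]]] := recession_step aC iM natt.
have [pC1 loc] := locally_polyhedral_tangent (polyhedral_locally pC C1).
apply: natt; apply: (esc loc); apply: (IH _ M1) => //.
by rewrite (leq_trans kM)// addSnnS leq_add2l.
Qed.

(** Iteration from an arbitrary cone; with the tangent cone of [D] as [C] it is [htan] by
    unfolding. *)
Definition higher_tangent C (vs : seq 'rV[R]_s) :=
  foldl (fun C' v => tangent_cone C' v) C vs.

Lemma admissible_multiplier C M : admissible C -> inv_mx C M ->
  exists us w ws,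
    let T us := higher_tangent C [seq u *m B | u <- us] in
    [/\ T us w, normal_cone (T us) w ws, g + ws *m B^T = 0 &
    forall l, (l < size us)%N ->
      [/\ T (take l us) (nth 0 us l *m B), ~ Lsp (T (take l us)) (nth 0 us l *m B),
          dot g (nth 0 us l) = 0 &
          ~ locally_polyhedral (T (take l us)) (nth 0 us l *m B)]].
Proof.
move=> aC iM.
have [k] : exists k, (s < k + \rank M)%N by exists s.+1; rewrite addSn ltnS leq_addr.
elim: k C M aC iM => [|k IH] C M aC iM kM.
  by have := rank_leq_row M; rewrite leqNgt kM.
have [/attained_multiplier[w [ws [Cw nw gw]]]|natt] := pselect (attained B g C).
  by exists [::], w, ws; split.
have [u1 [M1 [[C1 L1 g1] aC1 iM1 rM1 esc]]] := recession_step aC iM natt.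
have [|us [w [ws [Cw nw gw hus]]]] := IH _ M1 aC1 iM1.
  by rewrite (leq_trans kM)// addSnnS leq_add2l.
exists (u1 :: us), w, ws; split => //= -[|l] lus; last exact: hus.
(* Local polyhedrality would make the tangent cone polyhedral, hence the objective attained on it
   and then on [C]. *)
split => // lp; have [pC1 loc] := locally_polyhedral_tangent lp.
by apply: natt; apply: (esc loc); exact: (polyhedral_attained aC1 iM1).
Qed.

End Induction.

(** * From subregularity to the multiplier *)

(** Near 0, subregularity moves [u] to a feasible [u'], where the linear objective is nonnegative,
    at a cost proportional to the residual; homogeneity removes the restriction to a
    neighborhood. *)
Lemma subregular_exact_penalty (R : realType) (d s : nat) (B : 'M[R]_(d, s)) (g : 'rV[R]_d)
    (C : set 'rV[R]_s) :
  cone C -> (forall u, C (u *m B) -> 0 <= dot g u) ->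
  metric_subregular (fun u => [set u *m B - t | t in C]) 0 0 ->
  exists L, exact_penalty B g C L.
Proof.
move=> coneC pos [_ [W [/nbhs_ballP[r /= r0 rW] [kappa [k0 hW]]]]].
pose G := d%:R * `|g|; have G0 : 0 <= G by rewrite mulr_ge0.
exists (G * kappa); split; first by rewrite mulr_ge0// ltW.
have local u v : `|u| < r -> C v -> 0 <= dot g u + G * kappa * `|u *m B - v|.
  move=> ur Cv; apply/ler_addgt0Pr => e e0.
  have G1 : 0 < G + 1 by rewrite ltr_wpDl.
  have e'0 : 0 < e / (G + 1) by rewrite divr_gt0.
  have Wu : W u by apply: rW; rewrite -ball_normE /= sub0r normrN.
  have dist0 : (Defs.edist 0%R [set u *m B - t | t in C]%R <= `|u *m B - v|%:E)%E.
    by apply: ereal_inf_lbound; exists (u *m B - v); [exists v|rewrite sub0r normrN].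
  (* The distance is an infimum that may not be attained, hence the slack; multiplied by [G] it
     stays at most [e]. *)
  have : (Defs.edist u [set u' | [set u' *m B - t | t in C] 0]%R <
      (kappa * `|u *m B - v| + e / (G + 1))%:E)%E.
    apply: (le_lt_trans (hW u Wu)).
    apply: (le_lt_trans (lee_wpmul2l _ dist0)); first by rewrite lee_fin ltW.
    by rewrite -EFinM lte_fin ltrDl.
  move=> /ereal_inf_lt[_ [u' [t Ct /eqP ut0] <-]].
  move: ut0; rewrite subr_eq0 => /eqP ut; rewrite lte_fin => uu'.
  have gu' : 0 <= dot g u' by apply: pos; rewrite ut.
  have := le_trans (ler_norm _) (dot_le g (u' - u)).
  rewrite dotDr dotNr distrC -/G => h1.
  have h2 := ler_wpM2l G0 (ltW uu').
  have h3 : G * (e / (G + 1)) <= e.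
    by rewrite mulrA ler_pdivrMr// mulrC ler_pM2l// lerDl.
  lra.
move=> u v Cv; pose t := r / (`|u| + 1) / 2.
have u1 : 0 < `|u| + 1 by rewrite ltr_wpDl.
have t0 : 0 < t by rewrite !divr_gt0.
have tu : `|t *: u| < r.
  rewrite normrZ gtr0_norm//.
  have rE : r = t * (`|u| + 1) * 2 by rewrite /t; field; rewrite gt_eqF.
  have := mulr_gt0 t0 u1; have := mulr_ge0 (ltW t0) (normr_ge0 u); rewrite rE; lra.
have := local _ _ tu (coneC t v t0 Cv).
rewrite dotZr -scalemxAl -scalerBr normrZ (gtr0_norm t0) mulrCA -mulrDr.
by rewrite pmulr_rge0.
Qed.

Theorem theorem4p2 (R : realType) (d s : nat) (f : 'rV[R]_d -> R^o)
  (P : 'rV[R]_d -> 'rV[R]_s) (D : set 'rV[R]_s) (zbar : 'rV[R]_d) :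
  C1 f -> C1 P -> closed D ->
  (P @^-1` D) zbar ->
  B_stationary f (P @^-1` D) zbar ->
  GGCQ P D zbar ->
  metric_subregular
    (fun u => [set 'd P zbar u - t | t in tangent_cone D (P zbar)]) 0 0 ->
  exists (us : seq 'rV[R]_d) (w : 'rV[R]_s) (ws : 'rV[R]_s),
    htan D (P zbar) (map ('d P zbar) us) w /\
    normal_cone (htan D (P zbar) (map ('d P zbar) us)) w ws /\
    grad f zbar + adjD P zbar ws = 0 /\
    (forall l : nat, (1 <= l <= size us)%N ->
       lin_tan P D zbar (take l.-1 us) (nth 0 us l.-1) /\
       ~ Lsp (htan D (P zbar) (map ('d P zbar) (take l.-1 us))) ('d P zbar (nth 0 us l.-1)) /\
       dot (grad f zbar) (nth 0 us l.-1) = 0 /\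
       ~ locally_polyhedral (htan D (P zbar) (map ('d P zbar) (take l.-1 us)))
           ('d P zbar (nth 0 us l.-1))).
Proof.
move=> _ _ _ Dz stat ggcq subreg.
pose B := lin1_mx ('d P zbar); pose C := tangent_cone D (P zbar).
have AB : ('d P zbar : 'rV_d -> 'rV_s) = (fun u => u *m B).
  by apply/funext => u; rewrite mul_rV_lin1.
rewrite AB in subreg.
(* B-stationarity and GGCQ place the negative gradient in the polar of the linearized cone. *)
have pos u : C (u *m B) -> 0 <= dot (grad f zbar) u.
  move=> Cu; move: stat; rewrite /B_stationary ggcq => /(_ u).
  by rewrite dotNl oppr_le0; apply; rewrite /lin_tan /= AB.
have coneC : cone C by exact: tangent_cone_cone.
have [L pen] := subregular_exact_penalty coneC pos subreg.
have aC : admissible B (grad f zbar) L C.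
  by split=> //; [exact: tangent_cone_closed|exact: tangent_cone0].
have inv0 : inv_mx C (0 : 'M[R]_s) by move=> c l Cc; rewrite submx0 => /eqP ->; rewrite addr0.
have [us [w [ws [Tw nw gw hus]]]] := admissible_multiplier aC inv0.
exists us, w, ws; rewrite AB; split => //; split => //; split.
  rewrite -gw; congr (_ + _); apply/rowP => i.
  by rewrite mxE AB dot_mulmx dot_delta.
(* Directions are counted from 1 in the statement and from 0 in the sequence. *)
move=> [|l] // lus; have [Tl Ll gl pl] := hus l lus.
by rewrite /lin_tan AB; split.
Qed.
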